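(* Let $L,m,n\ge1$ be integers, let $y=mn$, and let $\mathbf{r}=(r_1,\dots,r_L)$ with $r_s>0$ satisfy $\sum_{i\in S}r_i<\min(|S|m,n)$ for every non-empty $S\subseteq\{1,\dots,L\}$. Let $k\ge1$ be the maximum $j$ such that $C_{m,n,j}(\mathbf{r})\le mn$. Then the achievable diversity order with $j\ge1$ feedback indices reduces to $$d_{opt}^j(\mathbf{r})=\begin{cases}C_{m,n,j}(\mathbf{r})&\text{for }j\le k,\\ \min\big(C_{m,n,j}(\mathbf{r}),\,mn+C_{m,n,1}(\mathbf{r})\big)&\text{for }j=k+1,\\ mn+C_{m,n,1}(\mathbf{r})&\text{for }j>k+1.\end{cases}$$
   Context: Setting: a multiple access channel with $L$ users, each with $m$ transmit antennas, a receiver with $n$ antennas, i.i.d. Rayleigh fading, and quantized feedback indices received in error with probability $\epsilon\doteq\mathsf{SNR}^{-y}$ (one index means no feedback). The vector of multiplexing gains is $\mathbf{r}$. $\mathbf{1}$ is the all-ones vector of length $L$. The function $D$ (outage-probability exponent at rates $r_s\log\mathsf{SNR}$ and powers of order $\mathsf{SNR}^p$): for $p>0$, $$D(\mathbf{r},\mathbf{1}p)=\min_{\emptyset\ne S\subseteq\{1,\dots,L\}}G_{|S|m,n}\Big(\sum_{i\in S}r_i,p\Big),$$ where, for positive integers $a,b$, with $q=\min(a,b)$, $M=\max(a,b)$ and $r>0$, $$G_{a,b}(r,p)=\inf\Big\{\sum_{i=1}^{q}(2i-1+M-q)\alpha_i:\ \alpha_1\ge\dots\ge\alpha_q\ge0,\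 \sum_{i=1}^q(p-\alpha_i)^+<r\Big\},\quad x^+=\max(x,0).$$ Recursions: $C_{m,n,0}(\mathbf{r})=\overline{C}_{m,n,0}(\mathbf{r})=0$ and for $j\ge1$ $$C_{m,n,j}(\mathbf{r})=D(\mathbf{r},\mathbf{1}(1+C_{m,n,j-1}(\mathbf{r}))),\qquad \overline{C}_{m,n,j}(\mathbf{r})=D(\mathbf{r},\mathbf{1}(1+\min(y,\overline{C}_{m,n,j-1}(\mathbf{r})))).$$ Achievable diversity order with $j$ feedback indices: $d_{opt}^1(\mathbf{r})=D(\mathbf{r},\mathbf{1})$ (no feedback), and for $j>1$, $d_{opt}^j(\mathbf{r})=\min(\overline{C}_{m,n,j}(\mathbf{r}),\,y+C_{m,n,1}(\mathbf{r}))$. *)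

(* Defs.v *)
From HB Require Import structures.
From mathcomp Require Import all_boot all_order all_algebra.
From mathcomp Require Import classical_sets reals.

Set Implicit Arguments.
Unset Strict Implicit.
Unset Printing Implicit Defensive.

Import Order.TTheory GRing.Theory Num.Theory.

Local Open Scope ring_scope.
Local Open Scope classical_set_scope.

Section Diversity.
Context {R : realType}.

Definition pospart (x : R) : R := Num.max x 0.

(* Indices start at 0, so the weight 2i - 1 + M - q of the i-th entry becomes
   2i + 1 + (M - q); the subtraction is not truncated, since q <= M. *)
Definition Gcost (a b : nat) (alpha : 'I_(minn a b) -> R) : R :=
  \sum_(i < minn a b) (2 * i + 1 + (maxn a b - minn a b))%:R * alpha i.

Definition Gfeasible (a b : nat) (r p : R) (alpha : 'I_(minn a b) -> R) : Prop :=
  [/\ forall i j : 'I_(minn a b), (i <= j)%N -> alpha j <= alpha i,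
      forall i, 0 <= alpha i
    & \sum_(i < minn a b) pospart (p - alpha i) < r].

(* For r > 0 the set is nonempty (take every entry equal to p, for p >= 0) and
   bounded below by 0, so [inf] is the genuine infimum. *)
Definition G (a b : nat) (r p : R) : R :=
  inf [set Gcost alpha | alpha in @Gfeasible a b r p].

Section Channel.
Variables (L m n : nat).

Definition Gset (r : 'I_L -> R) (p : R) (S : {set 'I_L}) : R :=
  G (#|S| * m) n (\sum_(i in S) r i) p.

(* [Dexp r p] is D(r, 1p), with the same power exponent p for all users. For
   0 < L the seed of the iterated minimum is the term of the nonempty set
   [set: 'I_L], so it does not affect the minimum. *)
Definition Dexp (r : 'I_L -> R) (p : R) : R :=
  \big[Order.min/Gset r p [set: 'I_L]%SET]_(S : {set 'I_L} | S != finset.set0)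
    Gset r p S.

Fixpoint C (r : 'I_L -> R) (j : nat) : R :=
  if j is j'.+1 then Dexp r (1 + C r j') else 0.

Fixpoint Cbar (y : R) (r : 'I_L -> R) (j : nat) : R :=
  if j is j'.+1 then Dexp r (1 + Num.min y (Cbar y r j')) else 0.

(* Meaningful for 1 <= j only; a single index (j = 1) means no feedback. *)
Definition dopt (y : R) (r : 'I_L -> R) (j : nat) : R :=
  if (j <= 1)%N then Dexp r 1 else Num.min (Cbar y r j) (y + C r 1).

End Channel.
End Diversity.

(* Main.v *)
(** The outage exponent [D] is monotone in the power, so [C] is nondecreasing
    and [Cbar] agrees with [C] up to index [k+1]; afterwards the cap [y = mn] is
    active and [Cbar] is constant, equal to [D(r, 1 + mn)].  It remains to see
    that [D(r, 1 + mn) >= mn + D(r, 1)].  With [q = min(a, b)], [M = max(a, b)]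
    and [t = mn >= q], let [alpha] be feasible at power [1 + t] and
    [s = sum (1 + t - alpha_i)^+ < r < q].  As the weights sum to [ab] and are
    at most [q + M - 1], [alpha] costs at least [(1 + t) ab - (q + M - 1) s].
    The constant vector [1 - s/q] is feasible at power [1] and costs
    [ab - M s]; the difference is at least [t ab - (q - 1) s >= t]. *)

Require Import Defs.
From HB Require Import structures.
From mathcomp Require Import all_boot all_order all_algebra.
From mathcomp Require Import classical_sets reals.
From mathcomp Require Import zify ring lra.

Set Implicit Arguments.
Unset Strict Implicit.
Unset Printing Implicit Defensive.

Import Order.TTheory GRing.Theory Num.Theory.

Local Open Scope ring_scope.

Lemma sum_weights (q d : nat) :
  (\sum_(i < q) (2 * i + 1 + d) = q * (q + d))%N.
Proof.
elim: q => [|q IHq]; first by rewrite big_ord0.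
rewrite big_ord_recr /= IHq; lia.
Qed.

Section OutageExponent.
Context {R : realType}.

Lemma sum_weightsR (a b : nat) :
  \sum_(i < minn a b) (2 * i + 1 + (maxn a b - minn a b))%:R
    = (minn a b)%:R * (maxn a b)%:R :> R.
Proof.
rewrite -natr_sum sum_weights subnKC; last by lia.
by rewrite natrM.
Qed.

Lemma pospart_ge0 (x : R) : 0 <= pospart x.
Proof. by rewrite /pospart le_max lexx orbT. Qed.

Lemma pospart_ge (x : R) : x <= pospart x.
Proof. by rewrite /pospart le_max lexx. Qed.

Lemma pospart_id (x : R) : 0 <= x -> pospart x = x.
Proof. by move=> x0; rewrite /pospart; apply/max_idPl. Qed.

Lemma le_pospart (x x' : R) : x <= x' -> pospart x <= pospart x'.
Proof.
by move=> xx'; rewrite /pospart ge_max !le_max xx' lexx orbT.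
Qed.

(** * The exponent [G] for one pair of dimensions *)

Section Fixed.
Variables a b : nat.
Implicit Types (r p c : R) (alpha : 'I_(minn a b) -> R).

Lemma Gcost_ge0 r p alpha : Gfeasible r p alpha -> 0 <= Gcost alpha.
Proof. by case=> _ a0 _; apply: sumr_ge0 => i _; rewrite mulr_ge0. Qed.

Lemma Gcost_const c :
  @Gcost R a b (fun=> c) = (minn a b)%:R * (maxn a b)%:R * c.
Proof. by rewrite /Gcost -mulr_suml sum_weightsR. Qed.

(** This witness makes the infimum in [G] run over a non-empty set; the positive part keeps it
    nonnegative for every real [p]. *)
Lemma Gfeasible_pospart r p : 0 < r ->
  Gfeasible r p (fun _ : 'I_(minn a b) => pospart p).
Proof.
move=> r0; split=> //; first by move=> _; exact: pospart_ge0.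
rewrite big1 // => i _; apply/max_idPr.
by rewrite subr_le0 pospart_ge.
Qed.

Lemma G_lower_bound r p c : 0 < r ->
  (forall alpha, Gfeasible r p alpha -> c <= Gcost alpha) -> c <= G a b r p.
Proof.
move=> r0 cP; apply: lb_le_inf.
  by exists (Gcost (fun _ : 'I_(minn a b) => pospart p));
    exists (fun=> pospart p) => //; exact: Gfeasible_pospart.
by move=> _ [alpha af <-]; exact: cP.
Qed.

Lemma G_le_Gcost r p alpha : Gfeasible r p alpha -> G a b r p <= Gcost alpha.
Proof.
move=> af; apply: ge_inf; last by exists alpha.
by exists 0 => _ [beta bf <-]; exact: Gcost_ge0 bf.
Qed.

(** Raising the power shrinks the feasible set. *)
Lemma le_G r p p' : 0 < r -> p <= p' -> G a b r p <= G a b r p'.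
Proof.
move=> r0 pp'; apply: G_lower_bound => // alpha [a1 a2 a3].
apply: G_le_Gcost; split=> //; apply: le_lt_trans a3.
by apply: ler_sum => i _; apply: le_pospart; rewrite lerD2r.
Qed.

(** Termwise: [alpha i >= p - pospart (p - alpha i)], and the weight in front of the positive part
    is replaced by the last and largest one, [q + M - 1]. *)
Lemma Gcost_ge p alpha :
  p * ((minn a b)%:R * (maxn a b)%:R)
    - ((minn a b)%:R + (maxn a b)%:R - 1)
      * (\sum_(i < minn a b) pospart (p - alpha i))
  <= Gcost alpha.
Proof.
rewrite -sum_weightsR !mulr_sumr -sumrB; apply: ler_sum => i _.
set w := (_ + _ + _)%:R; set W := (_ + _ - 1).
have w0 : 0 <= w by rewrite ler0n.
have wW : w <= W.
  rewrite /W lerBrDr -[1]/(1%:R) -!natrD ler_nat; have := ltn_ord i; lia.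
have x0 := pospart_ge0 (p - alpha i).
have xp := pospart_ge (p - alpha i).
move: (pospart _) x0 xp => x x0 xp.
have := ler_wpM2r x0 wW; have := ler_wpM2l w0 xp; lra.
Qed.

Lemma G_shift r t : 0 < r -> r < (minn a b)%:R -> (minn a b)%:R <= t ->
  t + G a b r 1 <= G a b r (1 + t).
Proof.
move=> r0 rq qt; apply: G_lower_bound => // alpha [_ _ a3].
have := Gcost_ge (1 + t) alpha.
have : 0 <= \sum_(i < minn a b) pospart (1 + t - alpha i).
  by apply: sumr_ge0 => i _; exact: pospart_ge0.
move: (\sum_(i < _) _) a3 => s sr s0 costa.
have q0 : 0 < (minn a b)%:R :> R by exact: lt_trans rq.
have q1 : 1 <= (minn a b)%:R :> R by rewrite ler1n -(ltr0n R).
have qM : (minn a b)%:R <= (maxn a b)%:R :> R by rewrite ler_nat; lia.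
(* Spreading [s] evenly over the [q] entries reproduces the sum [s < r] at power 1; the entries are
   nonnegative because [s < r < q]. *)
have bf : Gfeasible r 1 (fun _ : 'I_(minn a b) => 1 - s / (minn a b)%:R).
  split=> //.
    by move=> _; rewrite subr_ge0 ler_pdivrMr // mul1r ltW // (lt_trans sr).
  under eq_bigr do rewrite subKr pospart_id ?divr_ge0 // ?ltW //.
  by rewrite sumr_const card_ord -[_ *+ _]mulr_natr divfK ?gt_eqF.
have := G_le_Gcost bf; rewrite Gcost_const.
move: (minn a b)%:R (maxn a b)%:R q0 q1 qM rq qt costa {bf} => q M.
move=> q0 q1 qM rq qt costa.
have -> : q * M * (1 - s / q) = q * M - M * s by field; rewrite gt_eqF.
(* Factor by factor: [s < r < q <= t], and [q <= q * M]. *)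
have s_le_t : s * (q - 1) <= t * (q * M - 1).
  apply: ler_pM => //; [lra | lra | nra].
lra.
Qed.

End Fixed.

(** * The minimum over user sets and the two recursions *)

Section Channel.
Variables (L m n : nat) (r : 'I_L -> R).
Hypotheses (hL : (1 <= L)%N) (hr : forall s, 0 < r s).

Lemma sum_rates_gt0 (S : {set 'I_L}) : S != finset.set0 ->
  0 < \sum_(i in S) r i.
Proof.
case/set0Pn => i iS; rewrite (bigD1 i) //= ltr_wpDr //.
by apply: sumr_ge0 => j _; exact: ltW.
Qed.

(** The full set gives the seed of the minimum in [Dexp], so a lower bound has to hold there too. *)
Lemma setT_neq0 : [set: 'I_L]%SET != finset.set0.
Proof. by apply/set0Pn; exists (Ordinal hL). Qed.

Lemma Dexp_lower_bound c p :
  (forall S : {set 'I_L}, S != finset.set0 -> c <= Gset m n r p S) ->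
  c <= Dexp m n r p.
Proof. by move=> cP; apply/bigmin_geP; split; [apply/cP/setT_neq0|]. Qed.

Lemma Dexp_le_Gset p (S : {set 'I_L}) : S != finset.set0 ->
  Dexp m n r p <= Gset m n r p S.
Proof. exact: (bigmin_le_cond _ (Gset m n r p)). Qed.

Lemma Dexp_ge0 p : 0 <= Dexp m n r p.
Proof.
apply: Dexp_lower_bound => S S0; apply: G_lower_bound => [|alpha].
  exact: sum_rates_gt0.
exact: Gcost_ge0.
Qed.

Lemma le_Dexp p p' : p <= p' -> Dexp m n r p <= Dexp m n r p'.
Proof.
move=> pp'; apply: Dexp_lower_bound => S S0.
apply: le_trans (Dexp_le_Gset _ S0) _.
by apply: le_G => //; exact: sum_rates_gt0.
Qed.

Lemma Dexp_shift t :
  (forall S : {set 'I_L}, S != finset.set0 ->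
    \sum_(i in S) r i < (minn (#|S| * m) n)%:R) ->
  n%:R <= t -> t + Dexp m n r 1 <= Dexp m n r (1 + t).
Proof.
move=> hsum nt; apply: Dexp_lower_bound => S S0.
apply: le_trans (G_shift (sum_rates_gt0 S0) (hsum S S0) _).
  by rewrite lerD2l Dexp_le_Gset.
(* One bound on [t] serves all [S], since [q = min(|S|m, n) <= n]. *)
by apply: le_trans nt; rewrite ler_nat geq_minr.
Qed.

Lemma C_homo : {homo C m n r : i j / (i <= j)%N >-> i <= j}.
Proof.
apply: homo_leq => [//|j i l|]; first exact: le_trans.
elim=> [|j IHj]; first exact: Dexp_ge0.
by apply: le_Dexp; rewrite lerD2l.
Qed.

Lemma Cbar_homo y : 0 <= y -> {homo Cbar m n y r : i j / (i <= j)%N >-> i <= j}.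
Proof.
move=> y0; apply: homo_leq => [//|j i l|]; first exact: le_trans.
elim=> [|j IHj]; first exact: Dexp_ge0.
by apply: le_Dexp; rewrite lerD2l le_min !ge_min lexx IHj orbT.
Qed.

(** The cap acts on the preceding term only, so agreement extends one index past the last [C] below
    [y], that is, to [k.+1] in the theorem. *)
Lemma Cbar_eq_C y j : (forall i, (i < j)%N -> C m n r i <= y) ->
  Cbar m n y r j = C m n r j.
Proof.
elim: j => [//|j IHj] Cy.
rewrite [LHS]/= IHj; last by move=> i ij; apply/Cy/ltnW.
by rewrite (min_idPr (Cy j _)).
Qed.

End Channel.
End OutageExponent.

Theorem lemma6 (R : realType) (L m n : nat) (y : R) (r : 'I_L -> R) (k : nat)
  (hL : (1 <= L)%N) (hm : (1 <= m)%N) (hn : (1 <= n)%N)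
  (hy : y = (m * n)%:R)
  (hr : forall s : 'I_L, 0 < r s)
  (hsum : forall S : {set 'I_L}, S != finset.set0 ->
    \sum_(i in S) r i < (minn (#|S| * m) n)%:R)
  (hk1 : (1 <= k)%N)
  (hk : C m n r k <= (m * n)%:R)
  (hkmax : forall j : nat, C m n r j <= (m * n)%:R -> (j <= k)%N) :
  forall j : nat, (1 <= j)%N ->
    dopt m n y r j =
      if (j <= k)%N then C m n r j
      else if j == k.+1 then Num.min (C m n r j) ((m * n)%:R + C m n r 1)
      else (m * n)%:R + C m n r 1.
Proof.
move=> j j1; rewrite -hy in hk hkmax *.
have y0 : 0 <= y by rewrite hy ler0n.
have C1 : C m n r 1 = Dexp m n r 1 by rewrite /= addr0.
have C_le i : (i <= k)%N -> C m n r i <= y.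
  by move=> ik; apply: le_trans hk; exact: C_homo.
have CbarC i : (i <= k.+1)%N -> Cbar m n y r i = C m n r i.
  by move=> ik; apply: Cbar_eq_C => l li; apply: C_le; lia.
rewrite /dopt; case: (leqP j 1) => j_1.
  have -> : j = 1%N by lia.
  by rewrite hk1 C1.
case: ifP => [jk|/negbT]; last rewrite -ltnNge => kj.
  rewrite CbarC ?(leqW jk) //; apply/min_idPl.
  by rewrite (le_trans (C_le j jk)) // lerDl C1 Dexp_ge0.
case: eqP => [->|/eqP jk]; first by rewrite CbarC.
case: j j1 j_1 kj jk => [//|j] _ _ kj jk.
(* Here [j] is the predecessor of the original index, so [k.+1 <= j]. Maximality of [k] puts [C] at
   [k.+1] above [y], and monotonicity of [Cbar] keeps the cap active from there on. *)
have ykj : y <= Cbar m n y r j.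
  apply: le_trans (Cbar_homo m n hL hr y0 (_ : k.+1 <= j)%N); last by lia.
  by rewrite CbarC // ltW // ltNge; apply/negP => /hkmax; rewrite ltnn.
(* What remains is [y + D(r, 1) <= D(r, 1 + y)]. *)
apply/min_idPr; rewrite /= (min_idPl ykj) addr0.
by apply: Dexp_shift => //; rewrite hy ler_nat leq_pmull.
Qed.
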